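(* Let $\lambda,\mu,\theta,\gamma,c>0$ and $p\in[0,1]$, and consider the underloaded regime, in which the equilibrium $(q^*,s^* )$ of the fluid drift of the Erlang--$S^*$ model satisfies $q^*<s^*$. Then the Jacobian $J_{\mathrm{UL}}$ of the fluid drift at $(q^*,s^* )$ and the diffusion matrix $\Sigma_{\mathrm{UL}}$ at $(q^*,s^* )$ are $$J_{\mathrm{UL}}=\begin{pmatrix}-\mu&0\\ -p\mu&-\gamma\end{pmatrix},\qquad \Sigma_{\mathrm{UL}}=\begin{pmatrix}2\lambda&p\lambda\\ p\lambda&2p\lambda\end{pmatrix},$$ and the stationary covariance matrix $V_{\mathrm{UL}}=\begin{pmatrix}v_{qq}&v_{qs}\\ v_{qs}&v_{ss}\end{pmatrix}$ of the limiting Ornstein--Uhlenbeck process (whose entries are the diffusion approximations to $\mathrm{Var}(Q)$, $\mathrm{Var}(S)$, $\mathrm{Cov}(Q,S)$) is given by $$v_{qq}=\frac{\lambda}{\mu},\qquad v_{ss}=\frac{\lambda p}{\gamma},\qquad v_{qs}=0.$$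
   Context: The fluid drift of the Erlang--$S^*$ model is $b(q,s)=\big(\lambda-\mu\min\{q,s\}-\theta(q-s)^+,\ \gamma(c-s)-p\mu\min\{q,s\}\big)^\top$, with $x^+=\max\{x,0\}$; an equilibrium is a zero of $b$. The model has the following event types, with jump vector $\ell_k$ and rate $\beta_k(q,s)$: arrival $(1,0)$, $\lambda$; service completion without charging $(-1,0)$, $(1-p)\mu\min\{q,s\}$; service completion followed by charging $(-1,-1)$, $p\mu\min\{q,s\}$; abandonment $(-1,0)$, $\theta(q-s)^+$; return from charging $(0,1)$, $\gamma(c-s)$. The diffusion matrix at $(q^*,s^* )$ is $\Sigma=\sum_k\ell_k\ell_k^\top\beta_k(q^*,s^* )$. With $J$ the Jacobian of $b$ at $(q^*,s^* )$ and $W$ a standard two-dimensional Brownian motion, the limiting Ornstein--Uhlenbeck process is $d\widehat X(t)=J\widehat X(t)\,dt+\Sigma^{1/2}dW(t)$; its stationary covariance matrix $V$ is the unique solution of the Lyapunov equation $JV+VJ^\top+\Sigma=0$. *)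

(* Defs.v *)
From HB Require Import structures.
From mathcomp Require Import all_boot all_order all_algebra.
From mathcomp Require Import all_classical all_reals all_analysis.

Set Implicit Arguments.
Unset Strict Implicit.
Unset Printing Implicit Defensive.

Import Order.TTheory GRing.Theory Num.Theory.
Import numFieldNormedType.Exports.

Local Open Scope ring_scope.

Definition rv2 (R : Type) (a b : R) : 'rV[R]_2 :=
  \row_j (if j == 0 then a else b).

Definition cv2 (R : Type) (a b : R) : 'cV[R]_2 :=
  \col_i (if i == 0 then a else b).

Definition mx22 (R : Type) (a b c d : R) : 'M[R]_2 :=
  \matrix_(i, j)
    (if i == 0 then (if j == 0 then a else b) else (if j == 0 then c else d)).

Section ErlangSstar.
Variables (R : realType) (lambda mu theta gamma c p : R).

(* States and drift values are row vectors (q, s), because [jacobian] and the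
   differential calculus on matrices are developed for row vectors. *)
Definition drift (x : 'rV[R]_2) : 'rV[R]_2 :=
  let q := x 0 0 in let s := x 0 1 in
  rv2 (lambda - mu * Num.min q s - theta * Num.max (q - s) 0)
      (gamma * (c - s) - p * mu * Num.min q s).

(* [jacobian f x] acts on row vectors from the right: its (i, j) entry is the
   derivative of f_j along x_i.  The transpose is the usual Jacobian matrix,
   whose (i, j) entry is the derivative of f_i along x_j. *)
Definition drift_jacobian (q s : R) : 'M[R]_2 := (jacobian drift (rv2 q s))^T.

Inductive event :=
  | Arrival
  | ServiceNoCharging
  | ServiceCharging
  | Abandonment
  | ChargingReturn.

Definition events : seq event :=
  [:: Arrival; ServiceNoCharging; ServiceCharging; Abandonment; ChargingReturn].

Definition jump (k : event) : 'cV[R]_2 :=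
  match k with
  | Arrival => cv2 1 0
  | ServiceNoCharging => cv2 (-1) 0
  | ServiceCharging => cv2 (-1) (-1)
  | Abandonment => cv2 (-1) 0
  | ChargingReturn => cv2 0 1
  end.

Definition rate (k : event) (q s : R) : R :=
  match k with
  | Arrival => lambda
  | ServiceNoCharging => (1 - p) * mu * Num.min q s
  | ServiceCharging => p * mu * Num.min q s
  | Abandonment => theta * Num.max (q - s) 0
  | ChargingReturn => gamma * (c - s)
  end.

Definition diffusion_matrix (q s : R) : 'M[R]_2 :=
  \sum_(k <- events) rate k q s *: (jump k *m (jump k)^T).

End ErlangSstar.

Definition lyapunov (R : realType) (J Sigma V : 'M[R]_2) : Prop :=
  J *m V + V *m J^T + Sigma = 0.

(* The stationary covariance matrix of dX = J X dt + Sigma^(1/2) dW is the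
   unique solution of the Lyapunov equation; uniqueness is among all matrices,
   not only the symmetric ones. *)
Definition stationary_covariance (R : realType) (J Sigma V : 'M[R]_2) : Prop :=
  unique (lyapunov J Sigma) V.

(* Main.v *)
Require Import Defs.
From mathcomp Require Import all_boot all_order all_algebra.
From mathcomp Require Import all_classical all_reals all_analysis.
From mathcomp Require Import ring lra.

(** In the region [q < s] the drift is an affine function of the state, and
    this region is open; hence near the equilibrium the drift equals
    its first-order expansion with no error term.  It is therefore
    differentiable there, and its Jacobian is the linear part of the affine
    formula ([drift_underloaded], [near_underloaded], [locally_affine_diff]).

    The equilibrium equations read [lambda = mu * q] and
    [gamma * (c - s) = p * mu * q]: every event rate in the diffusion matrix is
    a multiple of [lambda], namely [lambda], [(1 - p) * lambda], [p * lambda],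
    [0] and [p * lambda].

    With this Jacobian and diffusion matrix, the Lyapunov equation is a
    triangular linear system in the entries of [V]; up to sign its pivots are
    [2 mu], [mu + gamma] (twice) and [2 gamma], all nonzero, so the solution is
    unique ([stationary_covariance_underloaded]).  The off-diagonal entry
    vanishes because [- p * mu * v_qq], by which fluctuations of [q] act on [s]
    through the departures to charging, cancels the covariance [p * lambda] of
    the noise when [v_qq = lambda / mu]. *)

Import Order.TTheory GRing.Theory Num.Theory.
Import numFieldNormedType.Exports.

Local Open Scope ring_scope.

(** The decomposition of the argument along the elementary matrices reduces the
    claim to the continuity of the coordinates. *)
Lemma mulmxr_continuous {K : realFieldType} {m n k} (A : 'M[K]_(n, k)) :
  continuous (mulmxr A : 'M[K]_(m, n) -> 'M[K]_(m, k)).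
Proof.
have -> : (mulmxr A : 'M[K]_(m, n) -> 'M[K]_(m, k)) =
    fun x => \sum_i \sum_j x i j *: (delta_mx i j *m A).
  apply/funext => x /=; rewrite {1}[x]matrix_sum_delta mulmx_suml.
  apply: eq_bigr => i _; rewrite mulmx_suml.
  by apply: eq_bigr => j _; rewrite scalemxAl.
move=> x; apply: (@cvg_big _ _ _ _ _ _ _ (nbhs x)) => [|i _].
  exact: add_continuous.
apply: (@cvg_big _ _ _ _ _ _ _ (nbhs x)) => [|j _].
  exact: add_continuous.
by apply: cvgZr_tmp; exact: coord_continuous.
Qed.

(** The remainder in the definition of differentiability vanishes identically
    near [x], so it is a little-o of anything. *)
Lemma locally_affine_diff {K : numFieldType} {V W : normedModType K}
    {f : V -> W} {df : {linear V -> W}} {x : V} :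
  continuous df -> (\forall y \near x, f y = f x + df (y - x)) ->
  differentiable f x /\ 'd f x = df :> (V -> W).
Proof.
move=> dfc faff.
have exp0 : f \o shift x = cst (f x) + df +o_ 0 id.
  apply/eqaddoP => _/posnumP[e].
  move/nbhs0P: faff => faff; near=> h.
  have fE : f (x + h) = f x + df (x + h - x) by near: h; exact: faff.
  by rewrite !fctE /= (addrC h) fE (addrC x h) addrK subrr normr0 mulr_ge0.
have dfE := diff_unique dfc exp0.
by split=> //; apply/diff_locallyP; rewrite dfE.
Unshelve. all: by end_near. Qed.

Lemma lin1_mx_mulmxr (K : comNzRingType) m n (A : 'M[K]_(m, n)) :
  lin1_mx (mulmxr A) = A.
Proof. by apply/row_matrixP => i; rewrite !rowE mul_rV_lin1. Qed.

Lemma sum_ord2 (V : nmodType) (F : 'I_2 -> V) : \sum_i F i = F 0 + F 1.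
Proof. by rewrite big_ord_recl big_ord1; congr (_ + F _); apply/val_inj. Qed.

Lemma mx22_eta (T : Type) (A : 'M[T]_2) :
  A = mx22 (A 0 0) (A 0 1) (A 1 0) (A 1 1).
Proof.
apply/matrixP => i j; rewrite mxE.
by case: ifP => i0; case: ifP => j0; congr (A _ _); apply/val_inj;
  case: i j i0 j0 => [[|[|//]] ?] [[|[|//]] ?].
Qed.

(** In the region [q < s] the minimum is [q] and the positive part is [0].  The
    matrix is the transpose of the usual Jacobian matrix, since it acts on row
    vectors from the right. *)
Lemma drift_underloaded {R : realType} (lambda mu theta gamma c p : R)
    {x y : 'rV[R]_2} : x 0 0 < x 0 1 -> y 0 0 < y 0 1 ->
  drift lambda mu theta gamma c p y = drift lambda mu theta gamma c p x +
    mulmxr (mx22 (- mu) (- (p * mu)) 0 (- gamma)) (y - x).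
Proof.
move=> xlt ylt; apply/rowP => j; rewrite /drift /rv2 !mxE.
rewrite !(min_l (ltW _)) // !(max_r (_ : _ - _ <= 0)) ?subr_le0 ?ltW //.
rewrite sum_ord2 !mxE /=.
by case: ifP => _; ring.
Qed.

Lemma near_underloaded {R : realType} {x : 'rV[R]_2} :
  x 0 0 < x 0 1 -> \forall y \near x, (y : 'rV[R]_2) 0 0 < y 0 1.
Proof.
move=> xlt.
have y0_lt : \forall y \near x, (y : 'rV[R]_2) 0 0 < (x 0 0 + x 0 1) / 2.
  apply: (@cvgr_lt _ _ (nbhs x) _ (fun y : 'rV[R]_2 => y 0 0)).
    exact: coord_continuous.
  by rewrite midf_lt.
have lt_y1 : \forall y \near x, (x 0 0 + x 0 1) / 2 < (y : 'rV[R]_2) 0 1.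
  apply: (@cvgr_gt _ _ (nbhs x) _ (fun y : 'rV[R]_2 => y 0 1)).
    exact: coord_continuous.
  by rewrite midf_lt.
by near=> y; apply: (@lt_trans _ _ ((x 0 0 + x 0 1) / 2)); near: y.
Unshelve. all: by end_near. Qed.

(** The entries are determined one after the other: [v_qq] by its own equation,
    then the two off-diagonal entries, then [v_ss].  Symmetry of the solution is
    a consequence, each off-diagonal entry being forced to vanish separately. *)
Lemma stationary_covariance_underloaded (R : realType) (lambda mu gamma p : R) :
  0 < mu -> 0 < gamma ->
  stationary_covariance (mx22 (- mu) 0 (- (p * mu)) (- gamma))
    (mx22 (2 * lambda) (p * lambda) (p * lambda) (2 * p * lambda))
    (mx22 (lambda / mu) 0 0 (lambda * p / gamma)).
Proof.
move=> mu_gt0 gamma_gt0.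
have mu_neq0 : mu != 0 by rewrite gt_eqF.
have gamma_neq0 : gamma != 0 by rewrite gt_eqF.
have mugamma_neq0 : mu + gamma != 0 by rewrite gt_eqF ?addr_gt0.
split.
  apply/matrixP => i j; rewrite !(mxE, sum_ord2) /=.
  by do 2 case: ifP => _; field; rewrite ?mu_neq0 ?gamma_neq0.
move=> V /matrixP VE.
have := (VE 0 0, VE 0 1, VE 1 0, VE 1 1).
rewrite !(mxE, sum_ord2) /= => -[[[E00 E01] E10] E11].
have mu_vqq : mu * V 0 0 = lambda by lra.
have vqs0 : V 0 1 = 0.
  apply: (mulfI mugamma_neq0); rewrite mulr0.
  have -> : (mu + gamma) * V 0 1 = p * (lambda - mu * V 0 0) by lra.
  by rewrite mu_vqq subrr mulr0.
have vsq0 : V 1 0 = 0.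
  apply: (mulfI mugamma_neq0); rewrite mulr0.
  have -> : (mu + gamma) * V 1 0 = p * (lambda - mu * V 0 0) by lra.
  by rewrite mu_vqq subrr mulr0.
have gamma_vss : gamma * V 1 1 = lambda * p.
  by move: E11; rewrite vqs0 vsq0; lra.
rewrite [V]mx22_eta vqs0 vsq0; congr mx22; first by rewrite -mu_vqq; field.
by rewrite -gamma_vss; field.
Qed.

Theorem theorem4p2 (R : realType) (lambda mu theta gamma c p q s : R)
  (lambda_gt0 : 0 < lambda) (mu_gt0 : 0 < mu) (theta_gt0 : 0 < theta)
  (gamma_gt0 : 0 < gamma) (c_gt0 : 0 < c) (p_01 : 0 <= p <= 1)
  (equilibrium : drift lambda mu theta gamma c p (rv2 q s) = 0)
  (underloaded : q < s) :
  let J := drift_jacobian lambda mu theta gamma c p q s in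
  let Sigma := diffusion_matrix lambda mu theta gamma c p q s in
  [/\ differentiable (drift lambda mu theta gamma c p) (rv2 q s),
      J = mx22 (- mu) 0 (- (p * mu)) (- gamma),
      Sigma = mx22 (2 * lambda) (p * lambda) (p * lambda) (2 * p * lambda)
    & stationary_covariance J Sigma
        (mx22 (lambda / mu) 0 0 (lambda * p / gamma))].
Proof.
move=> J Sigma.
have xlt : (rv2 q s) 0 0 < (rv2 q s) 0 1 by rewrite !mxE.
have [drift_diff dE] := locally_affine_diff (mulmxr_continuous _)
  (filterS (fun y => drift_underloaded lambda mu theta gamma c p xlt)
           (near_underloaded xlt)).
have JE : J = mx22 (- mu) 0 (- (p * mu)) (- gamma).
  rewrite /J /drift_jacobian /jacobian dE lin1_mx_mulmxr.
  by apply/matrixP => i j; rewrite !mxE; do 2 case: ifP.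
have [min_qs max_qs] : Num.min q s = q /\ Num.max (q - s) 0 = 0.
  by split; [apply/min_l/ltW | apply/max_r; rewrite subr_le0 ltW].
have muqE : mu * q = lambda.
  have := congr1 (fun x : 'rV_2 => x 0 0) equilibrium.
  by rewrite !mxE /= min_qs max_qs; lra.
have gammaE : gamma * (c - s) = p * lambda.
  have := congr1 (fun x : 'rV_2 => x 0 1) equilibrium.
  by rewrite !mxE /= min_qs -mulrA muqE; lra.
have SigmaE :
    Sigma = mx22 (2 * lambda) (p * lambda) (p * lambda) (2 * p * lambda).
  rewrite /Sigma /diffusion_matrix /events !big_cons big_nil /rate.
  rewrite min_qs max_qs gammaE -!mulrA muqE.
  apply/matrixP => i j; rewrite !(mxE, big_ord1) /=.
  by do 2 case: ifP => _; ring.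
by split; rewrite // JE SigmaE; exact: stationary_covariance_underloaded.
Qed.
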